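(* Let $p:\mathbb{N}\to[0,1]$ be a natural function. Then there is a typFPT-algorithm for $k$-Clique on graphs $G\in\mathcal{G}(n,p)$; that is, there is a deterministic algorithm $\mathcal{A}$ which, on every input graph $G$ and integer $k$, correctly decides whether $G$ contains a clique of size $k$, and for which there exist a function $f$ and a polynomial $P$ such that for every $k\in\mathbb{N}$ and every polynomial $q$ there is $n_0\in\mathbb{N}$ such that for all $n>n_0$, $$\Pr\big[t_{\mathcal{A}}(\mathcal{G}(n,p),k) > f(k)\cdot P(n)\big] < \frac{1}{q(n)},$$ where $t_{\mathcal{A}}(\mathcal{G}(n,p),k)$ denotes the running time of $\mathcal{A}$ on input $(G,k)$ with $G$ drawn from $\mathcal{G}(n,p)$.
   Context: $k$-Clique is the problem: given a graph $G$ and a positive integer $k$ (the parameter), decide whether $G$ contains a complete subgraph on $k$ vertices. $\mathcal{G}(n,p)$ denotes the Erdős–Rényi random graph on vertex set $\{1,\dots,n\}$ in which each pair of vertices is joined by an edge independently with probability $p=p(n)$. A function $p:\mathbb{N}\to[0,1]$ is called natural if either $p(n)=0$ for all $n\in\mathbb{N}$, or $p(n)=n^{-g(n)}$ for a non-negative function $g$ such that the limit $\lim_{n\to\infty} g(n)$ exists. *)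

(* Defs.v *)
From HB Require Import structures.
From mathcomp Require Import all_boot all_order all_algebra.
From mathcomp Require Import all_classical all_reals all_analysis.
Import Order.TTheory GRing.Theory Num.Theory.
Import numFieldNormedType.Exports.

Set Implicit Arguments.
Unset Strict Implicit.
Unset Printing Implicit Defensive.

Local Open Scope ring_scope.
Local Open Scope classical_set_scope.

(** Graphs on the vertex set 'I_n, given by their sets of two-element edges. *)

Definition vpairs (n : nat) : {set {set 'I_n}} :=
  [set e : {set 'I_n} | #|e| == 2%N]%SET.

Record sgraph (n : nat) := SGraph {
  edges : {set {set 'I_n}};
  edges_vpairs : edges \subset vpairs n }.

HB.instance Definition _ n := [isSub for @edges n].
HB.instance Definition _ n := [Finite of sgraph n by <:].

Definition adj n (G : sgraph n) (x y : 'I_n) : bool :=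
  [set x; y]%SET \in edges G.

Definition has_clique n (G : sgraph n) (k : nat) : bool :=
  [exists S : {set 'I_n},
     (#|S| == k) && [forall x in S, forall y in S, (x != y) ==> adj G x y]].

(** The distribution G(n, r): the 'C(n, 2) edge indicators are independent
    Bernoulli variables with parameter r. *)

Definition gnp_mass (R : realType) n (r : R) (G : sgraph n) : R :=
  \prod_(e in vpairs n) (if e \in edges G then r else 1 - r).

Definition gnp_prob (R : realType) n (r : R) (ev : pred (sgraph n)) : R :=
  \sum_(G : sgraph n | ev G) gnp_mass r G.

(* The equation for [p n] is not imposed at n = 0, where a negative power of n
   is meaningless. *)
Definition natural_fun (R : realType) (p : nat -> R) : Prop :=
  (forall n, p n = 0) \/
  exists g : nat -> R,
    [/\ forall n, 0 <= g n,
        forall n, (0 < n)%N -> p n = n%:R `^ (- g n)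
      & cvg (g n @[n --> \oo])].

(** Algorithms are programs of a random access machine with the uniform cost
    measure, whose arithmetic is addition, truncated subtraction and halving (no
    unit-cost multiplication, so that running times are polynomially related to
    those of Turing machines).  Data lives in an unbounded memory, reached only
    by indirect reads and writes; a program uses the finitely many registers that it
    mentions. *)

Inductive instr :=
  | IConst of nat & nat        (* r_i := c                            *)
  | IAdd of nat & nat & nat    (* r_i := r_j + r_l                    *)
  | ISub of nat & nat & nat    (* r_i := r_j - r_l, truncated at 0    *)
  | IHalf of nat & nat         (* r_i := floor (r_j / 2)              *)
  | IRead of nat & nat         (* r_i := mem[r_j]                     *)
  | IWrite of nat & nat        (* mem[r_i] := r_j                     *)
  | IJump of nat               (* goto l                              *)
  | IJumpZ of nat & nat        (* if r_i = 0 then goto l              *)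
  | IHalt.

Definition program := seq instr.

Record config := Config {
  prog_ctr : nat; reg : nat -> nat; memory : nat -> nat }.

(* Running past the end of the program amounts to halting. *)
Definition current (A : program) (c : config) : instr :=
  nth IHalt A (prog_ctr c).

Definition halted (A : program) (c : config) : bool :=
  if current A c is IHalt then true else false.

Definition step (A : program) (c : config) : config :=
  let: Config l0 r m := c in
  let set_reg i v := Config l0.+1 [eta r with i |-> v] m in
  match current A c with
  | IConst i a => set_reg i a
  | IAdd i j l => set_reg i (r j + r l)%N
  | ISub i j l => set_reg i (r j - r l)%N
  | IHalf i j => set_reg i (r j)./2
  | IRead i j => set_reg i (m (r j))
  | IWrite i j => Config l0.+1 r [eta m with r i |-> r j]
  | IJump l => Config l r m
  | IJumpZ i l => Config (if r i == 0%N then l else l0.+1) r m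
  | IHalt => c
  end.

Definition run (A : program) (t : nat) (c : config) : config :=
  iter t (step A) c.

(* The input (G, k) is n, k and the adjacency matrix of G in row-major order,
   written at the start of the memory; everything else is 0. *)
Definition input n (G : sgraph n) (k : nat) : seq nat :=
  [:: n, k & [seq nat_of_bool (adj G x y) | x <- enum 'I_n, y <- enum 'I_n]].

Definition init n (G : sgraph n) (k : nat) : config :=
  Config 0 (fun=> 0%N) (nth 0%N (input G k)).

(* The answer is read in register 0: 1 for yes, 0 for no. *)
Definition decides_clique (A : program) : Prop :=
  forall n (G : sgraph n) (k : nat), exists t : nat,
    halted A (run A t (init G k)) /\
    reg (run A t (init G k)) 0 = nat_of_bool (has_clique G k).

(* Number of steps before halting, +oo if the computation does not halt. *)
Definition runtime (R : realType) (A : program) n (G : sgraph n) (k : nat)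
    : \bar R :=
  ereal_inf [set t%:R%:E | t in [set t | halted A (run A t (init G k))]].

(* Main.v *)
(* Depth-first search for a clique v_1 > v_2 > ... > v_k, the candidates for each v_i
   being tried in increasing order, is fast with overwhelming probability for every
   natural p.

   If p = 0 or g tends to a positive limit, then n^2 p^s <= 1 eventually for some s.  By the
   union bound, G(n, p) contains K_{s,t} with probability at most
   n^(s+t) p^(st) <= n^(s-t).  When there is no K_{s,t}, every partial clique with at
   least s vertices has fewer than t extensions, so the search tree has at most about
   n^(s+1) t^k nodes.  The constant t depends on q, but t^k <= n for large n.

   If g tends to 0, then n p^M >= 1 eventually for every M.  Split the first
   v ~ n^(1/k) vertices into v/k blocks of size k: the blocks are cliques independently
   of each other, so that one of them is a clique with overwhelming probability.
   Because of the order of the candidates, the search then never leaves the first v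
   vertices and visits O(v^k) = O(n) nodes. *)

Require Import Defs.
From HB Require Import structures.
From mathcomp Require Import all_boot all_order all_algebra.
From mathcomp Require Import all_classical all_reals all_analysis.
From mathcomp Require Import zify ring lra.
Import Order.TTheory GRing.Theory Num.Theory.
Import numFieldNormedType.Exports.

(** * The program *)

(* The numbers in the margin are jump targets.  The stack of chosen vertices lies
   behind the adjacency matrix, from register 3 to register 4: a frame for u is the
   pair of cells u, 2 + u * n, the second one being the address of row u.  The bottom
   frame holds n, a strict bound on the first vertex.  Register 2 counts the vertices
   still to be chosen, registers 5 and 6 hold the candidate and its row address, and
   registers 9 and 10 are scratch.  Block 14 dispatches, 18 checks the candidate
   against the stack, 28 pushes it, 36 backtracks and 43 moves to the next one. *)
Definition clique_prog : program :=
  [:: IConst 7 1; IConst 8 2; IRead 1 0; IRead 2 7; IConst 3 2; IAdd 5 1 0;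
      (*  6 *) IJumpZ 5 10; IAdd 3 3 1; ISub 5 5 7; IJump 6;
      (* 10 *) IAdd 4 3 0; IAdd 9 4 7; IWrite 4 1; IConst 6 2;
      (* 14 *) IJumpZ 2 46; IRead 9 4; ISub 9 9 5; IJumpZ 9 36;
      (* 18 *) IAdd 10 4 0;
      (* 19 *) ISub 9 10 3; IJumpZ 9 28; IAdd 9 10 7; IRead 9 9; IAdd 9 9 5;
               IRead 9 9; IJumpZ 9 43; ISub 10 10 8; IJump 19;
      (* 28 *) IAdd 4 4 8; IWrite 4 5; IAdd 9 4 7; IWrite 9 6; ISub 2 2 7;
               IConst 5 0; IConst 6 2; IJump 14;
      (* 36 *) ISub 9 4 3; IJumpZ 9 47; IRead 5 4; IAdd 9 4 7; IRead 6 9;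
               ISub 4 4 8; IAdd 2 2 7;
      (* 43 *) IAdd 5 5 7; IAdd 6 6 1; IJump 14;
      (* 46 *) IConst 0 1 ].

Definition reach (T : nat) (c : config) (Q : config -> Prop) : Prop :=
  exists2 t, t <= T & Q (run clique_prog t c).

Lemma reach_now T c (Q : config -> Prop) : Q c -> reach T c Q.
Proof. by exists 0. Qed.

Lemma reach_step T c Q : reach T (step clique_prog c) Q -> reach T.+1 c Q.
Proof. by case=> t tT Qt; exists t.+1; rewrite // /run iterSr. Qed.

Lemma reach_trans T1 T2 c Q1 Q2 :
  reach T1 c Q1 -> (forall c', Q1 c' -> reach T2 c' Q2) -> reach (T1 + T2) c Q2.
Proof.
case=> t1 t1T Q1t /(_ _ Q1t)[t2 t2T Q2t]; exists (t2 + t1).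
  by rewrite addnC leq_add.
by rewrite /run iterD.
Qed.

Lemma reach_weaken {T} T' {c Q} : T <= T' -> reach T c Q -> reach T' c Q.
Proof. by move=> TT' [t tT Qt]; exists t => //; exact: leq_trans TT'. Qed.

Definition answers (b : bool) (c : config) : Prop :=
  halted clique_prog c /\ reg c 0 = nat_of_bool b.

(** * The recursive search and its simulation by the machine *)

Section Search.
Variables (n k : nat) (e : rel nat).

Definition compat (s : seq nat) (v : nat) : bool := all (fun u => e u v) s.

(* Whether the search accepts from stack [s] (last chosen vertex first) with [r]
   vertices still to be chosen and next candidate below [v]. *)
Fixpoint found (r : nat) (s : seq nat) (v : nat) : bool :=
  if r is r'.+1 then
    has (fun u => compat s u && found r' (u :: s) u) (iota 0 v)
  else true.

(** Size of the full search tree, not cut short by a success: a rejected candidate weighs 1, an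
    accepted one 2 more than its subtree, for the push and the return. *)
Fixpoint nodes (r : nat) (s : seq nat) (v : nat) : nat :=
  if r is r'.+1 then
    \sum_(0 <= u < v) (if compat s u then (nodes r' (u :: s) u).+2 else 1)
  else 1.

Definition base := 2 + n * n.

Definition matrix_at (m : nat -> nat) : Prop :=
  forall u v, u < n -> v < n -> m (2 + u * n + v) = e u v.

Fixpoint stack_at (s : seq nat) (m : nat -> nat) : Prop :=
  if s is u :: s' then
    [/\ u < n, m (base + (size s).*2) = u,
        m (base + (size s).*2).+1 = 2 + u * n & stack_at s' m]
  else m base = n.

(** Registers 9 and 10 are left free. Register 0 stays 0 until acceptance: it serves as the constant
    zero and as the answer no. *)
Definition inv (r : nat) (s : seq nat) (v : nat) (rg m : nat -> nat) : Prop :=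
  [/\ [seq rg i | i <- iota 0 9] =
        [:: 0; n; r; base; base + (size s).*2; v; 2 + v * n; 1; 2],
      matrix_at m & stack_at s m].

Definition at_inv (l r : nat) (s : seq nat) (v : nat) (c : config) : Prop :=
  exists rg m, c = Config l rg m /\ inv r s v rg m.

Lemma stack_head s m : stack_at s m -> m (base + (size s).*2) = head n s.
Proof. by case: s => [|u s] /=; [rewrite addn0|case]. Qed.

Lemma head_le s m : stack_at s m -> head n s <= n.
Proof. by case: s => [|u s] //= [/ltnW]. Qed.

Lemma stack_write s m a x : base + (size s).*2 + 1 < a ->
  stack_at s m -> stack_at s [eta m with a |-> x].
Proof.
elim: s => [|u s IHs] /= lt_a.
  by case: eqP => // ea; move: lt_a; rewrite -ea; lia.
case=> un m1 m2 ms; split=> //.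
- by case: eqP => // ea; lia.
- by case: eqP => // ea; lia.
- by apply: IHs => //; lia.
Qed.

Lemma matrix_write m a x : base <= a ->
  matrix_at m -> matrix_at [eta m with a |-> x].
Proof.
move=> lea mm u v un vn /=; case: eqP => [ea|_]; last exact: mm.
by move: lea; rewrite -ea /base; nia.
Qed.

Ltac exec := apply: reach_step; rewrite /step /current /=.

Lemma next_step r s v rg m : inv r s v rg m ->
  reach 3 (Config 43 rg m) (at_inv 14 r s v.+1).
Proof.
case=> [[h0 h1 h2 h3 h4 h5 h6 h7 h8] mm ss].
do 3 exec; apply: reach_now; eexists; eexists; split; first by [].
split=> //=; rewrite h0 h1 h2 h3 h4 h5 h6 h7 h8.
by congr [:: _, _, _, _, _, _, _ & _]; lia.
Qed.

Lemma push_step r s v rg m : v < n -> inv r.+1 s v rg m ->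
  reach 8 (Config 28 rg m) (at_inv 14 r (v :: s) 0).
Proof.
move=> vn [[h0 h1 h2 h3 h4 h5 h6 h7 h8] mm ss].
do 8 exec; apply: reach_now; eexists; eexists; split; first by [].
split=> /=; rewrite ?(h0, h1, h2, h3, h4, h5, h6, h7, h8).
- by congr [:: _, _, _, _, _ & _]; lia.
- do 2![apply: matrix_write; first by rewrite /base; lia]; exact: mm.
- have -> : base + (size s).*2 + 2 = base + (size s).+1.*2 by lia.
  rewrite addn1; split=> //.
  + by rewrite eqn_leq ltnn andbF eqxx.
  + by rewrite eqxx.
  + do 2![apply: stack_write; first by lia]; exact: ss.
Qed.

Lemma back_step r s u v rg m : inv r (u :: s) v rg m ->
  reach 10 (Config 36 rg m) (at_inv 14 r.+1 s u.+1).
Proof.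
case=> [[h0 h1 h2 h3 h4 h5 h6 h7 h8] mm [un m1 m2 ss]].
do 2 exec; rewrite h4 h3 /= ifF; last by apply/eqP; lia.
do 8 exec; apply: reach_now; eexists; eexists; split; first by [].
split=> //=; rewrite h0 h1 h2 h3 h4 h7 h8 !addn1 m1 m2.
by congr [:: _, _, _, _, _, _, _ & _]; rewrite /=; lia.
Qed.

(** Induction on [s'], the part of the stack still to be checked, with register 10 at its top frame;
    one pass takes nine steps. *)
Lemma check_loop r s v s' rg m : inv r s v rg m -> v < n ->
  rg 10 = base + (size s').*2 -> stack_at s' m ->
  reach (9 * size s' + 2) (Config 19 rg m)
    (at_inv (if compat s' v then 28 else 43) r s v).
Proof.
elim: s' rg => [|u s' IHs] rg iv vn h10 ss';
  have [[h0 h1 h2 h3 h4 h5 h6 h7 h8] mm ss] := iv.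
  exec; exec; rewrite h10 h3 addn0 subnn /=.
  by apply: reach_now; eexists; eexists; split=> //; split.
move: ss' => /= [un m1 m2 ss'].
have -> : 9 * (size s').+1 + 2 = (9 * size s' + 2).+4.+4.+1 by lia.
exec; exec; rewrite h10 h3 /= ifF; last by apply/eqP; lia.
do 5 exec; rewrite h7 h10 addn1 m2 h5 mm //.
case euv: (e u v) => /=; last first.
  by apply: reach_now; eexists; eexists; split=> //; split.
do 2 exec; apply: IHs => //=; last by rewrite h10 h8 /=; lia.
Qed.

Lemma candidate r s v rg m : inv r.+1 s v rg m -> v < head n s ->
  reach (9 * size s + 15) (Config 14 rg m)
    (if compat s v then at_inv 14 r (v :: s) 0 else at_inv 14 r.+1 s v.+1).
Proof.
move=> iv vs; have [[h0 h1 h2 h3 h4 h5 h6 h7 h8] mm ss] := iv.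
have vn : v < n := leq_trans vs (head_le _ _ ss).
have -> : 9 * size s + 15 = (9 * size s + 2 + 8).+4.+1 by lia.
exec; rewrite h2 /=; do 3 exec.
rewrite h4 (stack_head _ _ ss) h5 ifF; last by apply/eqP; lia.
exec; apply: (reach_trans _ _ _ (at_inv (if compat s v then 28 else 43) r.+1 s v)).
  by apply: check_loop => //=; rewrite h4 h0 addn0.
move=> _ [rg' [m' [-> iv']]]; case: (compat s v) in iv' *.
  exact: push_step.
exact: reach_weaken (next_step _ _ _ _ _ iv').
Qed.

Lemma exhausted r s v rg m : inv r.+1 s v rg m -> head n s <= v ->
  reach 4 (Config 14 rg m) (at_inv 36 r.+1 s v).
Proof.
move=> iv vs; have [[h0 h1 h2 h3 h4 h5 h6 h7 h8] mm ss] := iv.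
exec; rewrite h2 /=; do 3 exec.
rewrite h4 (stack_head _ _ ss) h5; have -> : head n s - v = 0 by lia.
by apply: reach_now; eexists; eexists; split=> //; split.
Qed.

Definition step_cost := 9 * k + 40.

(** Outer induction on [r], inner on [v]. A failed search returns to the stack [s] with candidate
    [v], so that it can be continued. As [v] may lie below [head n s], a success below [v] is paid
    for by the nodes below [v] alone. *)
Lemma search r s v rg m : size s + r = k -> v <= head n s ->
  inv r s 0 rg m ->
  reach (step_cost * nodes r s v) (Config 14 rg m)
    (fun c => if found r s v then answers true c else at_inv 14 r s v c).
Proof.
elim: r s v rg m => [|r IHr] s v rg m szk.
  move=> _ [[_ _ h2 _ _ _ _ _ _] _ _].
  apply: (@reach_weaken 2); first by rewrite /= /step_cost; lia.
  by exec; rewrite h2 /=; exec; apply: reach_now.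
elim: v => [|v IHv] vs iv.
  by apply: reach_now => /=; exists rg, m.
have -> : found r.+1 s v.+1 =
    found r.+1 s v || (compat s v && found r (v :: s) v).
  by rewrite /found -/found -addn1 iotaD has_cat /= orbF add0n.
have -> : step_cost * nodes r.+1 s v.+1 = step_cost * nodes r.+1 s v +
    step_cost * (if compat s v then (nodes r (v :: s) v).+2 else 1).
  by rewrite /= big_nat_recr //= mulnDr.
apply: reach_trans (IHv (ltnW vs) iv) _ => c.
case: (found r.+1 s v) => /=; first exact: reach_now.
move=> [rg1 [m1 [-> iv1]]]; have szk' : size (v :: s) + r = k by rewrite /=; lia.
have := candidate _ _ _ _ _ iv1 vs.
case: (compat s v) => /= cand; last first.
  by apply: reach_weaken cand; rewrite /step_cost; lia.
have -> : step_cost * (nodes r (v :: s) v).+2 =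
    step_cost + (step_cost * nodes r (v :: s) v + step_cost) by lia.
apply: reach_trans (reach_weaken _ _ cand) _; first by rewrite /step_cost; lia.
move=> _ [rg2 [m2 [-> iv2]]].
apply: reach_trans (IHr _ v _ _ szk' _ iv2) _ => // c'.
case fnd: found => /=; first exact: reach_now.
(* With nothing left to choose the search succeeds, so after a failure [r] is positive: the
   candidates below [v] have run out and the machine backtracks. *)
case: r {IHr IHv iv iv1 iv2 cand szk'} szk fnd => // r szk _ [rg3 [m3 [-> iv3]]].
apply: (@reach_weaken (4 + 10)); first by rewrite /step_cost; lia.
apply: reach_trans (exhausted _ _ _ _ _ iv3 _) _ => //.
by move=> _ [rg4 [m4 [-> iv4]]]; exact: back_step iv4.
Qed.

Lemma search_root rg m : inv k [::] 0 rg m ->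
  reach (step_cost * (nodes k [::] n).+1) (Config 14 rg m)
    (answers (found k [::] n)).
Proof.
move=> iv; rewrite mulnS addnC.
apply: reach_trans (search _ [::] n _ _ _ _ iv) _ => // c.
case fnd: (found k [::] n); first exact: reach_now.
case: {1 2}k fnd => // k' _ [rg1 [m1 [-> iv1]]].
apply: (@reach_weaken (4 + 2)); first by rewrite /step_cost; lia.
apply: reach_trans (exhausted _ _ _ _ _ iv1 _) _ => //.
move=> _ [rg2 [m2 [-> [[h0 h1 h2 h3 h4 h5 h6 h7 h8] _ _]]]].
(* Only the bottom frame is left: the jump leaves the program with register 0 still 0. *)
exec; exec; rewrite h4 h3 addn0 subnn /=; exact: reach_now.
Qed.

Lemma setup m : m 0 = n -> m 1 = k -> matrix_at m ->
  reach (4 * n + 11) (Config 0 (fun=> 0) m) (at_inv 14 k [::] 0).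
Proof.
move=> m0 m1 mm.
(* The address [base] is computed by [n] additions of [n]; register 5 counts the [i] that remain. *)
have loop i rg : i <= n -> [seq rg j | j <- iota 0 9] =
    [:: 0; n; k; 2 + (n - i) * n; 0; i; 0; 1; 2] ->
    reach (4 * i + 5) (Config 6 rg m) (at_inv 14 k [::] 0).
  elim: i rg => [|i IHi] rg ile [h0 h1 h2 h3 h4 h5 h6 h7 h8].
    exec; rewrite h5 /=; do 4 exec; apply: reach_now.
    eexists; eexists; split; first by [].
    split=> /=; rewrite ?h0 ?h1 ?h2 ?h3 ?h4 ?h5 ?h7 ?h8 subn0 !addn0 ?eqxx //.
    exact: matrix_write.
  have -> : 4 * i.+1 + 5 = (4 * i + 5).+4 by lia.
  exec; rewrite h5 /=; do 3 exec; apply: IHi; first by lia.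
  rewrite /= h0 h1 h2 h3 h4 h5 h6 h7 h8.
  by congr [:: _, _, _, _, _, _ & _]; [nia|lia].
have -> : 4 * n + 11 = (4 * n + 5).+4.+2 by lia.
by do 6 exec; apply: loop => //=; rewrite m0 m1 subnn mul0n !addn0.
Qed.

End Search.

(** * Correctness and running time *)

(** [w] lists the vertices chosen after [s] in the order of choice, hence decreasing. *)
Lemma foundP (e : rel nat) r s v :
  reflect (exists w, [/\ size w = r, all (gtn v) w, all (compat e s) w &
                      pairwise (fun a b => (b < a) && e a b) w])
          (found e r s v).
Proof.
elim: r s v => [|r IHr] s v /=.
  by apply: ReflectT; exists [::].
apply: (iffP hasP) => [[u]|[[|u w]]].
  rewrite mem_iota add0n => /= uv /andP[su /IHr[w [szw wu sw pw]]].
  exists (u :: w); split=> /=; first by rewrite szw.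
  - by rewrite uv; apply: sub_all wu => x /= /ltn_trans; apply.
  - by rewrite su; apply: sub_all sw => x /= /andP[].
  - rewrite pw andbT all_predI wu /=.
    by apply: sub_all sw => x /= /andP[].
- by case.
case=> /= [[szw]] /andP[uv wv] /andP[su sw] /andP[uw pw].
exists u; first by rewrite mem_iota.
rewrite su; apply/IHr; exists w; split=> //.
  by apply: sub_all uw => x /andP[].
have : all (predI (e u) (compat e s)) w.
  by rewrite all_predI sw andbT; apply: sub_all uw => x /andP[].
by apply: sub_all => x.
Qed.

Definition nat_adj {n} (G : sgraph n) : rel nat :=
  fun u v => [exists x : 'I_n, exists y : 'I_n,
    [&& x == u :> nat, y == v :> nat & adj G x y]].

Lemma nat_adjE n (G : sgraph n) (x y : 'I_n) : nat_adj G x y = adj G x y.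
Proof.
apply/existsP/idP => [[x' /existsP[y' /and3P[]]]|xy].
  by move=> /eqP/val_inj-> /eqP/val_inj->.
by exists x; apply/existsP; exists y; rewrite !eqxx.
Qed.

Lemma adj_sym n (G : sgraph n) : symmetric (adj G).
Proof. by move=> x y; rewrite /adj finset.setUC. Qed.

Lemma adj_irr n (G : sgraph n) : irreflexive (adj G).
Proof.
move=> x; apply/negP => /(fintype.subsetP (edges_vpairs G)).
by rewrite inE finset.setUid cards1.
Qed.

Lemma nat_adj_sym n (G : sgraph n) : symmetric (nat_adj G).
Proof.
by move=> u v; apply/existsP/existsP => -[x /existsP[y /and3P[xu yv xy]]];
  exists y; apply/existsP; exists x; rewrite xu yv adj_sym.
Qed.

Lemma pairwise_sym_in (T : eqType) (r : rel T) s : symmetric r ->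
  pairwise r s -> {in s &, forall x y, x != y -> r x y}.
Proof.
move=> rs; elim: s => //= a s IHs /andP[/allP ra pw] x y.
rewrite !inE => /orP[/eqP->|xs] /orP[/eqP->|ys].
- by rewrite eqxx.
- by move=> _; exact: ra.
- by rewrite rs => _; exact: ra.
- exact: IHs.
Qed.

Lemma card_ord_set n (w : seq nat) : uniq w -> all (gtn n) w ->
  #|[set x : 'I_n | val x \in w]%SET| = size w.
Proof.
move=> uw wn; have sz : map val (pmap insub w : seq 'I_n) = w.
  rewrite pmap_filter; last exact: insubK.
  by apply/all_filterP; apply: sub_all wn => x xn; rewrite isSome_insub.
have up : uniq (pmap insub w : seq 'I_n) by apply: (@map_uniq _ _ val); rewrite sz.
rewrite -[in RHS]sz size_map -(card_uniqP up); apply: eq_card => x.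
by rewrite inE -[in LHS]sz mem_map //; exact: val_inj.
Qed.

(** The search meets a clique in decreasing order, so sorting its vertices that way gives the
    sequence required by [foundP]. *)
Lemma found_has_clique n (G : sgraph n) k :
  found (nat_adj G) k [::] n = has_clique G k.
Proof.
apply/foundP/existsP => [[w [szw wn _ pw]]|[S /andP[/eqP cS /forall_inP adjS]]].
  have /andP[/pairwise_uniq uw pe] :
      pairwise ltn (rev w) && pairwise (nat_adj G) w.
    have := pw; rewrite pairwise_relI => /andP[pg ->]; rewrite andbT.
    by rewrite -(sorted_pairwise ltn_trans) rev_sorted
      (sorted_pairwise (rev_trans ltn_trans)).
  exists [set x : 'I_n | val x \in w]%SET; apply/andP; split.
    by rewrite card_ord_set ?szw // -rev_uniq; apply: uw => x; exact: ltnn.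
  apply/forall_inP => x; rewrite inE => xw.
  apply/forall_inP => y; rewrite inE => yw; apply/implyP => xy.
  by rewrite -nat_adjE (pairwise_sym_in _ _ _ (@nat_adj_sym n G) pe).
set w := sort geq (map val (enum S)).
have mw x : x \in w = (x \in map val (enum S)) by rewrite mem_sort.
have wS x : x \in w -> exists2 y, y \in S & x = val y.
  by rewrite mw => /mapP[y]; rewrite mem_enum; exists y.
have sw : sorted gtn w.
  rewrite gtn_sorted_uniq_geq sort_uniq map_inj_uniq ?enum_uniq /=; last first.
    exact: val_inj.
  by apply: sort_sorted => x y; rewrite /geq /= leq_total.
exists w; split; rewrite ?all_predT //.
- by rewrite size_sort size_map -cardE.
- by apply/allP => x /wS[y _ ->] /=.
rewrite (sorted_pairwise (rev_trans ltn_trans)) in sw.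
apply: (@sub_in_pairwise _ [in w] gtn) sw; last by apply/allP.
move=> x y /wS[x' x'S ->] /wS[y' y'S ->] /= yx; rewrite yx nat_adjE.
have /forall_inP/(_ y' y'S)/implyP := adjS _ x'S; apply.
by apply: contraTN yx => /eqP->; rewrite ltnn.
Qed.

Lemma nth_allpairs (S T U : Type) (f : S -> T -> U) s t x0 y0 z0 i j :
  i < size s -> j < size t ->
  nth z0 [seq f x y | x <- s, y <- t] (i * size t + j) =
  f (nth x0 s i) (nth y0 t j).
Proof.
elim: s i => // x s IHs [|i] /= si tj; rewrite nth_cat size_map.
  by rewrite tj (nth_map y0).
rewrite ifF; last by apply/negbTE; lia.
by rewrite -IHs //; congr (nth _ _ _); lia.
Qed.

Lemma input_matrix n (G : sgraph n) k :
  matrix_at n (nat_adj G) (memory (init G k)).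
Proof.
case: n G => [|n] G u v // un vn /=.
have -> : u * n.+1 = u * size (enum 'I_n.+1) by rewrite size_enum_ord.
rewrite (nth_allpairs _ _ _ _ _ _ ord0 ord0) ?size_enum_ord //.
by rewrite -nat_adjE !nth_enum_ord.
Qed.

Lemma clique_prog_decides : decides_clique clique_prog.
Proof.
move=> n G k; rewrite -found_has_clique.
have [//|//||t _] := setup n k (nat_adj G) (memory (init G k)).
  exact: input_matrix.
rewrite -/(init G k) => -[rg [m [E iv]]].
have [t' _ []] := search_root _ _ _ _ _ iv; rewrite -E.
by exists (t' + t); rewrite /run iterD.
Qed.

(** First vertices are tried in increasing order, so a success below [v] ends the run before [v] is
    tried; the choice [v = n] covers every graph. *)
Lemma clique_prog_time (R : realType) n (G : sgraph n) k (v : nat) :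
  v <= n -> found (nat_adj G) k [::] v || (v == n) ->
  (@runtime R clique_prog n G k <=
   (4 * n + 11 + step_cost k * (nodes (nat_adj G) k [::] v).+1)%:R%:E)%E.
Proof.
move=> vn fnd.
suff [t tT [ht _]] : reach (4 * n + 11 +
    step_cost k * (nodes (nat_adj G) k [::] v).+1) (init G k)
    (answers (found (nat_adj G) k [::] v)).
  apply: ereal_inf_le; exists (t%:R%:E)%E; first by exists t.
  by rewrite lee_fin ler_nat.
apply: reach_trans (setup n k _ _ _ _ (input_matrix n G k)) _ => //.
move=> _ [rg [m [-> iv]]].
case/orP: fnd => [fnd|/eqP->]; last exact: search_root.
rewrite mulnS addnC.
apply: (@reach_weaken (step_cost k * nodes (nat_adj G) k [::] v)); first by lia.
by have := search _ _ _ k [::] v _ _ erefl vn iv; rewrite fnd.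
Qed.

(** * Size of the search tree *)

(** A candidate whose subtree has size at most [X >= 1] contributes at most [X + 2 <= 3 * X]. *)
Lemma nodes_le (e : rel nat) r s v m :
  v <= m -> nodes e r s v <= (3 * m) ^ r.
Proof.
elim: r s v => //= r IHr s [|v] vm; first by rewrite big_nil.
have X0 : 0 < (3 * m) ^ r by rewrite expn_gt0; lia.
apply: (@leq_trans (\sum_(0 <= u < v.+1) 3 * (3 * m) ^ r)).
  rewrite !big_nat; apply: leq_sum => u /= uv; case: ifP => _; last by lia.
  by have := IHr (u :: s) u (leq_trans (ltnW uv) vm); lia.
by rewrite sum_nat_const_nat subn0 expnS; nia.
Qed.

(** The list is a stack: the last chosen, smallest vertex comes first. *)
Definition descending_clique (n : nat) (e : rel nat) (s : seq nat) : bool :=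
  all (gtn n) s && pairwise (fun a b => (a < b) && e b a) s.

(** With [X] the bound for a child, [v] candidates cost at most [2 * v] plus [X] for each compatible
    one. The leading factor [3 * n.+1] gives [2 * v <= X], so a level costs a factor of at most
    [t.+1] once [d] vertices are chosen, and at most [n.+1] before. *)
Lemma nodes_le_sparse (n : nat) (e : rel nat) (d t : nat) :
  (forall s, descending_clique n e s -> d <= size s ->
     count (compat e s) (iota 0 (head n s)) <= t) ->
  forall r s v, descending_clique n e s -> v <= head n s ->
  nodes e r s v <= 3 * n.+1 * (3 * n.+1) ^ (d - size s) * t.+1 ^ r.
Proof.
move=> few; elim=> [|r IHr] s v dcs vs.
  by rewrite /= expn0 muln1; have := expn_gt0 (3 * n.+1) (d - size s); lia.
have hdn : head n s <= n.
  by case: s dcs {vs} => //= a s /andP[/= /andP[/ltnW]].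
set X := 3 * n.+1 * (3 * n.+1) ^ (d - (size s).+1) * t.+1 ^ r.
have le_sum : nodes e r.+1 s v <= 2 * v + count (compat e s) (iota 0 v) * X.
  have -> : 2 * v + count (compat e s) (iota 0 v) * X =
      \sum_(0 <= u < v) (2 + compat e s u * X).
    rewrite big_split /= sum_nat_const_nat subn0 mulnC -big_distrl /=.
    rewrite -sum1_count [in LHS]big_mkcond /index_iota subn0.
    by congr (_ + _ * _); apply: eq_bigr => u _; case: compat.
  rewrite /= big_seq [leqRHS]big_seq; apply: leq_sum => u.
  rewrite mem_index_iota => /= uv; case su: (compat e s u) => //.
  rewrite mul1n add2n !ltnS; apply: IHr => //=.
  move: dcs => /andP[sn pw]; rewrite /descending_clique /= sn pw !andbT.
  rewrite (leq_trans uv (leq_trans vs hdn)) /=.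
  have us : all (ltn u) s.
    case: s pw vs {X hdn sn su} => //= a s /andP[/allP as_ _] va.
    have ua := leq_trans uv va; rewrite ua /=; apply/allP => x /as_ /andP[].
    by move/(ltn_trans ua).
  by apply/allP => x xs; apply/andP; split; [exact: (allP us)|exact: (allP su)].
apply: leq_trans le_sum _.
have cv : count (compat e s) (iota 0 v) <= n.
  by rewrite (leq_trans (count_size _ _)) ?size_iota // (leq_trans vs).
have X1 : 3 * n.+1 <= X by rewrite /X -mulnA leq_pmulr // muln_gt0 !expn_gt0.
have vX : 2 * v <= X by lia.
have [ds|sd] := leqP d (size s).
  have ct : count (compat e s) (iota 0 v) <= t.
    apply: leq_trans (few _ dcs ds); rewrite -[head n s](subnKC vs) iotaD count_cat.
    exact: leq_addr.
  apply: (@leq_trans (t.+1 * X)); first by rewrite mulSn leq_add // leq_mul2r ct orbT.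
  by rewrite /X (eqP ds) (eqP (leqW ds)) mulnCA expnS.
apply: (@leq_trans (n.+1 * X)); first by rewrite mulSn leq_add // leq_mul2r cv orbT.
have -> : 3 * n.+1 * (3 * n.+1) ^ (d - size s) * t.+1 ^ r.+1 =
    3 * n.+1 * t.+1 * X.
  by rewrite /X -[in LHS](subnSK sd) !expnS; ring.
by rewrite leq_mul2r mulnAC leq_pmull ?orbT.
Qed.

Definition biclique n (d t : nat) (G : sgraph n) : bool :=
  [exists S : {set 'I_n}, exists T : {set 'I_n},
    [&& #|S| == d, #|T| == t & [forall x in S, forall y in T, adj G x y]]].

(** If a partial clique on at least [d] vertices had more than [t] extensions, [d] of its vertices
    and [t] of the extensions would form a biclique. *)
Lemma nodes_le_biclique n (G : sgraph n) d t r : ~~ biclique n d t G ->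
  nodes (nat_adj G) r [::] n <= (3 * n.+1) ^ d.+1 * t.+1 ^ r.
Proof.
move=> nob; rewrite expnS -[d in _ ^ d]subn0.
apply: nodes_le_sparse (leqnn _) => // s /andP[sn pw] ds.
rewrite leqNgt; apply: contra nob => /ltnW; rewrite -size_filter.
set c := [seq _ <- _ | _] => tc.
have us : uniq s.
  by apply: pairwise_uniq pw => x; rewrite ltnn.
have cP x : x \in take t c -> (x < n) && compat (nat_adj G) s x.
  move/mem_take; rewrite mem_filter mem_iota add0n => /andP[sx /= xs].
  apply/andP; split; last exact: sx.
  by rewrite (leq_trans xs) //; case: (s) sn => //= a s' /andP[/ltnW].
apply/existsP; exists [set x : 'I_n | val x \in take d s]%SET.
apply/existsP; exists [set x : 'I_n | val x \in take t c]%SET.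
rewrite !card_ord_set ?size_takel ?eqxx ?take_uniq ?filter_uniq ?iota_uniq //=.
- apply/forall_inP => x; rewrite inE => /mem_take xs.
  apply/forall_inP => y; rewrite inE => /cP/andP[_ /allP/(_ _ xs)].
  by rewrite nat_adjE.
- by apply/allP => x /cP/andP[].
- by apply/allP => x /mem_take; apply: (allP sn).
Qed.

Local Open Scope ring_scope.

(** * Random graphs *)

Section RandomGraph.
Variables (R : realType) (n : nat) (r : R).
Hypothesis r01 : 0 <= r <= 1.

(** Expanding the product gives a sum over all families of vertex sets; those that are not edge sets
    of graphs contribute 0. *)
Lemma sum_sgraph (a b : {set 'I_n} -> R) :
  (forall e, e \notin vpairs n -> a e = 0) ->
  \sum_(G : sgraph n) \prod_e (if e \in edges G then a e else b e) =
  \prod_e (a e + b e).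
Proof.
move=> a0; rewrite bigA_distr (bigID (fun J : {set {set 'I_n}} => J \subset vpairs n)) /=.
rewrite [X in _ + X]big1 ?addr0 => [|J /subsetPn[e eJ /a0 ae]]; last first.
  by rewrite (bigD1 e) //= eJ ae mul0r.
pose G0 : sgraph n := SGraph (finset.sub0set _).
rewrite (reindex_onto (@edges n) (insubd G0)) /=; last first.
  by move=> J JV; exact: (insubdK G0).
by apply: eq_bigl => G; rewrite edges_vpairs valKd eqxx.
Qed.

Lemma expect_subset (F : {set {set 'I_n}}) : F \subset vpairs n ->
  \sum_(G : sgraph n) gnp_mass r G * (F \subset edges G)%:R = r ^+ #|F|.
Proof.
move=> FV.
(* As [b] vanishes on [F], only graphs containing [F] survive; [a e + b e] is [r] on [F] and 1
   elsewhere. *)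
pose a e := if e \in vpairs n then r else 0.
pose b e := if e \in vpairs n then (if e \in F then 0 else 1 - r) else 1.
rewrite (_ : r ^+ #|F| = \prod_e (a e + b e)); last first.
  rewrite -prodr_const big_mkcond; apply: eq_bigr => e _; rewrite /a /b.
  case: ifP => [/(fintype.subsetP FV)->|_]; first by rewrite addr0.
  by case: ifP => _; rewrite ?add0r // addrC subrK.
rewrite -sum_sgraph => [|e /negPf eV]; last by rewrite /a eV.
apply: eq_bigr => G _; rewrite /gnp_mass.
have GV := fintype.subsetP (edges_vpairs G).
have [FG|/subsetPn[e eF eG]] := boolP (F \subset edges G); last first.
  rewrite mulr0 (bigD1 e) //= (negPf eG) /b (fintype.subsetP FV _ eF) eF.
  by rewrite mul0r.
rewrite mulr1 big_mkcond; apply: eq_bigr => e _; rewrite /a /b.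
have [/GV->//|eG] := boolP (e \in edges G).
by rewrite (contraNF (fintype.subsetP FG e)).
Qed.

Lemma gnp_mass_ge0 (G : sgraph n) : 0 <= gnp_mass r G.
Proof.
by have /andP[r0 r1] := r01; apply: prodr_ge0 => e _; case: ifP => _; lra.
Qed.

Lemma gnp_probE (ev : pred (sgraph n)) :
  gnp_prob r ev = \sum_G gnp_mass r G * (ev G)%:R.
Proof.
by rewrite /gnp_prob big_mkcond; apply: eq_bigr => G _; rewrite mulr_natr mulrb.
Qed.

Lemma gnp_prob_le (ev ev' : pred (sgraph n)) :
  (forall G, ev G -> ev' G) -> gnp_prob r ev <= gnp_prob r ev'.
Proof.
move=> sub; rewrite !gnp_probE; apply: ler_sum => G _.
apply: ler_wpM2l; first exact: gnp_mass_ge0.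
by rewrite ler_nat; case: (ev G) (sub G) => // ->.
Qed.

Lemma gnp_prob_union (I : finType) (A : {pred I}) (F : I -> {set {set 'I_n}}) k :
  (forall i, i \in A -> F i \subset vpairs n) ->
  (forall i, i \in A -> #|F i| = k) ->
  gnp_prob r (fun G => [exists i in A, F i \subset edges G]) <=
  #|A|%:R * r ^+ k.
Proof.
move=> FV Fk; rewrite gnp_probE.
apply: (@le_trans _ _ (\sum_(i in A) r ^+ k)); last by rewrite sumr_const mulr_natl.
rewrite [leRHS](eq_bigr (fun i =>
    \sum_G gnp_mass r G * (F i \subset edges G)%:R)) /=; last first.
  by move=> i iA; rewrite expect_subset ?FV ?Fk.
rewrite exchange_big /=; apply: ler_sum => G _.
rewrite -mulr_sumr; apply: ler_wpM2l; first exact: gnp_mass_ge0.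
have [/exists_inP[i iA FG]|_] := boolP [exists i in A, F i \subset edges G].
  rewrite (bigD1 i) //= FG lerDl; exact: sumr_ge0.
exact: sumr_ge0.
Qed.

(* Inclusion-exclusion, once in each direction: the expansions of
   [\prod_i (1 - X_i)] and of [\prod_i (1 - r ^+ #|F i|)] agree term by term. *)
Lemma gnp_prob_none (I : finType) (F : I -> {set {set 'I_n}}) :
  (forall i, F i \subset vpairs n) ->
  (forall i j, i != j -> [disjoint F i & F j]%B) ->
  gnp_prob r (fun G => [forall i, ~~ (F i \subset edges G)]) =
  \prod_i (1 - r ^+ #|F i|).
Proof.
move=> FV Fdis; rewrite gnp_probE.
under [RHS]eq_bigr do rewrite addrC.
rewrite bigA_distr /=.
transitivity (\sum_(J : {set I}) (-1) ^+ #|J| *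
    \sum_G gnp_mass r G * (\bigcup_(i in J) F i \subset edges G)%:R).
  under [RHS]eq_bigr do rewrite mulr_sumr.
  rewrite exchange_big /=; apply: eq_bigr => G _.
  under [RHS]eq_bigr do rewrite mulrCA.
  rewrite -mulr_sumr; congr (_ * _).
  transitivity (\prod_i (- (F i \subset edges G)%:R + 1 : R)).
    have [/forallP none|/forallPn[i]] := boolP [forall i, ~~ (F i \subset edges G)].
      by rewrite big1 // => i _; rewrite (negPf (none i)) oppr0 add0r.
    by rewrite negbK => FG; rewrite (bigD1 i) //= FG addNr mul0r.
  rewrite bigA_distr /=; apply: eq_bigr => J _.
  rewrite -big_mkcond /= prodrN; congr (_ * _).
  have [/bigcupsP sub|nsub] := boolP (\bigcup_(i in J) F i \subset edges G).
    by rewrite big1 // => i iJ; rewrite sub.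
  have /existsP[i /andP[iJ nF]] : [exists i, (i \in J) && ~~ (F i \subset edges G)].
    apply: contraR nsub => /existsPn none; apply/bigcupsP => i iJ.
    by have := none i; rewrite iJ negbK.
  by rewrite (bigD1 i) //= (negPf nF) mul0r.
apply: eq_bigr => J _; rewrite -big_mkcond /= prodrN; congr (_ * _).
rewrite expect_subset; last by apply/bigcupsP => i _; exact: FV.
rewrite prodrXr; congr (_ ^+ _).
(* Since the [F i] are disjoint, the size of their union is the sum of their sizes. *)
rewrite -sum1_card [in LHS](big_mkcond (fun i => i \in J) F).
rewrite partition_disjoint_bigcup /= => [|i j ij].
  rewrite [RHS]big_mkcond; apply: eq_bigr => i _.
  by case: ifP => _; rewrite ?big_set0 ?sum1_card.
rewrite -finset.setI_eq0.
by do 2!case: ifP => _; rewrite ?finset.set0I ?finset.setI0 // finset.setI_eq0 Fdis.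
Qed.

End RandomGraph.

(** * Bicliques in the random graph *)

Lemma bin_le_expn n m : ('C(n, m) <= n ^ m)%N.
Proof.
apply: (@leq_trans (n ^_ m)); first by rewrite -bin_ffact leq_pmulr ?fact_gt0.
rewrite ffact_prod -[m in (n ^ m)%N]card_ord -prod_nat_const.
by apply: leq_prod => i _; exact: leq_subr.
Qed.

Definition cross_pairs n (ST : {set 'I_n} * {set 'I_n}) : {set {set 'I_n}} :=
  [set [set u.1; u.2] | u in finset.setX ST.1 ST.2]%SET.

Lemma card_cross_pairs n (S T : {set 'I_n}) : [disjoint S & T] ->
  #|cross_pairs n (S, T)| = (#|S| * #|T|)%N.
Proof.
move=> dST; rewrite -cardsX card_in_imset // => -[x y] [x' y'] /=.
rewrite !finset.in_setX /= => /andP[xS yT] /andP[x'S y'T] eq2.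
have no z : z \in S -> z \in T -> False.
  by move=> zS; rewrite (disjointFr dST zS).
have xx : x = x'.
  have: x \in [set x'; y']%SET by rewrite -eq2 !inE eqxx.
  by rewrite !inE => /orP[/eqP//|/eqP xy]; case: (no x); rewrite // xy.
have : y \in [set x'; y']%SET by rewrite -eq2 !inE eqxx orbT.
rewrite !inE => /orP[/eqP yx|/eqP->]; last by rewrite xx.
by case: (no y); rewrite // yx.
Qed.

Lemma cross_pairs_sub n (S T : {set 'I_n}) : [disjoint S & T] ->
  cross_pairs n (S, T) \subset vpairs n.
Proof.
move=> dST; apply/fintype.subsetP => e /imsetP[[x y]].
rewrite finset.in_setX /= => /andP[xS yT] ->; rewrite inE cards2.
by case: (x =P y) => [xy|//]; move: yT; rewrite -xy (disjointFr dST xS).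
Qed.

Lemma gnp_prob_biclique (R : realType) n (r : R) d t : 0 <= r <= 1 ->
  gnp_prob r (biclique n d t) <= n%:R ^+ (d + t) * r ^+ (d * t).
Proof.
move=> r01.
pose A := [pred ST : {set 'I_n} * {set 'I_n} |
  [&& #|ST.1| == d, #|ST.2| == t & [disjoint ST.1 & ST.2]]].
apply: (@le_trans _ _ (#|A|%:R * r ^+ (d * t))); last first.
  rewrite ler_wpM2r ?exprn_ge0 //; first by case/andP: r01.
  rewrite -natrX ler_nat expnD.
  apply: (@leq_trans ('C(n, d) * 'C(n, t))); last by rewrite leq_mul ?bin_le_expn.
  rewrite -[n in 'C(n, d)]card_ord -[n in 'C(n, t)]card_ord -!card_draws -cardsX.
  apply: subset_leq_card; apply/fintype.subsetP => -[S T] /and3P[/= cS cT _].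
  by rewrite finset.in_setX !inE cS.
apply: le_trans (gnp_prob_union _ _ _ r01 _ A (@cross_pairs n) (d * t) _ _).
- apply: gnp_prob_le => // G /existsP[S /existsP[T /and3P[cS cT /forall_inP ST]]].
  apply/existsP; exists (S, T); rewrite !inE /= cS cT /=; apply/andP; split.
    (* Adjacency is irreflexive, so the two sides of a biclique are disjoint. *)
    apply/pred0P => x /=; apply/andP => -[xS xT].
    by have /forall_inP/(_ _ xT) := ST _ xS; rewrite adj_irr.
  apply/fintype.subsetP => _ /imsetP[[x y] /finset.setXP[xS yT] ->] /=.
  by have /forall_inP/(_ _ yT) := ST _ xS.
- by move=> [S T] /and3P[_ _ dST]; exact: cross_pairs_sub.
- by move=> [S T] /and3P[/= /eqP<- /eqP<- dST]; exact: card_cross_pairs.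
Qed.

(** * Cliques on disjoint blocks of vertices *)

Definition block n (k i : nat) : {set 'I_n} := [set x : 'I_n | (x %/ k)%N == i]%SET.

Lemma card_block n k i : (0 < k)%N -> (#|block n k i| <= k)%N.
Proof.
move=> k0; rewrite -[k in (_ <= k)%N]card_ord.
have kP (x : 'I_n) : (x %% k < k)%N by rewrite ltn_mod.
rewrite -(card_in_imset (f := fun x : 'I_n => Ordinal (kP x))) ?max_card //.
move=> x y; rewrite !inE => /eqP xi /eqP yi [xy]; apply: val_inj => /=.
by rewrite (divn_eq x k) (divn_eq y k) xi yi xy.
Qed.

Lemma found_block n (G : sgraph n) k B i : (k * B <= n)%N -> (i < B)%N ->
  vpairs n :&: powerset (block n k i) \subset edges G ->
  found (nat_adj G) k [::] (k * B).
Proof.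
move=> kBn iB sub; apply/foundP.
have wP x : x \in rev (iota (k * i) k) -> (x < k * B)%N /\ (x %/ k)%N = i.
  rewrite mem_rev mem_iota => /andP[le lt]; split; first by nia.
  have k0 : (0 < k)%N by lia.
  by apply/eqP; rewrite eqn_leq -ltnS ltn_divLR // leq_divRL //; apply/andP; nia.
exists (rev (iota (k * i) k)); split.
- by rewrite size_rev size_iota.
- by apply/allP => x /wP[].
- exact: all_predT.
have pg : pairwise gtn (rev (iota (k * i) k)).
  by rewrite -(sorted_pairwise (rev_trans ltn_trans)) rev_sorted iota_ltn_sorted.
apply: (@sub_in_pairwise _ [in rev (iota (k * i) k)] gtn) pg; last by apply/allP.
move=> x y /wP[xB xi] /wP[yB yi] /= yx; rewrite yx /=.
rewrite -[x]/(val (Ordinal (leq_trans xB kBn))).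
rewrite -[y]/(val (Ordinal (leq_trans yB kBn))) nat_adjE.
apply: (fintype.subsetP sub); rewrite !inE cards2 neq_ltn yx orbT /=.
by apply/fintype.subsetP => z; rewrite !inE => /orP[]/eqP->; apply/eqP.
Qed.

(** Distinct blocks share no pair, so their completeness is independent. The number of pairs in a
    block is bounded crudely by its [2 ^ k] subsets. *)
Lemma gnp_prob_not_found (R : realType) n (r : R) k B : 0 <= r <= 1 ->
  (0 < k)%N -> (k * B <= n)%N ->
  gnp_prob r (fun G : sgraph n => ~~ found (nat_adj G) k [::] (k * B)) <=
  (1 - r ^+ (2 ^ k)) ^+ B.
Proof.
move=> r01 k0 kBn; have /andP[r0 r1] := r01.
pose F (i : 'I_B) := vpairs n :&: powerset (block n k i).
apply: (@le_trans _ _ (gnp_prob r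
    (fun G : sgraph n => [forall i, ~~ (F i \subset edges G)]))).
  apply: gnp_prob_le => // G; apply: contraNT => /forallPn[i]; rewrite negbK.
  exact: found_block.
rewrite gnp_prob_none //.
- rewrite -[B in leRHS]card_ord -prodr_const; apply: ler_prod => i _.
  rewrite subr_ge0 exprn_ile1 //= lerB //; apply: ler_wiXn2l => //.
  apply: (@leq_trans #|powerset (block n k i)|).
    by apply: subset_leq_card; exact: finset.subsetIr.
  by rewrite card_powerset leq_exp2l // card_block.
- by move=> i; exact: finset.subsetIl.
- move=> i j ij; rewrite -finset.setI_eq0; apply/finset.set0Pn => -[e].
  rewrite !inE => /andP[/andP[/eqP e2 /fintype.subsetP ei] /andP[_ /fintype.subsetP ej]].
  have /card_gt0P[x xe] : (0 < #|e|)%N by rewrite e2.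
  move: ij (ei _ xe) (ej _ xe); rewrite !inE => /eqP ij /eqP xi /eqP xj.
  by apply: ij; apply: val_inj; rewrite /= -xi -xj.
Qed.

(** * Natural functions *)

Lemma natural_fun_dichotomy (R : realType) (p : nat -> R) : natural_fun p ->
  (exists d n0 : nat, forall n : nat, (n0 < n)%N -> n%:R ^+ 2 * p n ^+ d <= 1) \/
  (forall M : nat, exists n0 : nat, forall n : nat, (n0 < n)%N ->
     1 <= n%:R * p n ^+ M).
Proof.
case=> [p0|[g [g0 pg /cvg_ex[/= l gl]]]].
  by left; exists 1%N, 0%N => n _; rewrite p0 expr1 mulr0.
have pX n m d : (0 < n)%N ->
    n%:R ^+ m * p n ^+ d = n%:R `^ (m%:R - g n * d%:R).
  move=> n0; rewrite pg // -[in LHS]powR_mulrn ?ler0n //.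
  rewrite -[X in _ * X]powR_mulrn ?powR_ge0 // -powRrM -powRD ?mulNr //.
  by rewrite pnatr_eq0 -lt0n n0 implybT.
have [l0|l0] := ltP 0 l; [left|right].
- have l20 : l / 2 < l by lra.
  have [N _ gN] := cvgr_gt _ gl _ l20.
  (* Eventually [g n > l / 2], and [d > 4 / l] then gives [g n * d >= 2]. *)
  exists (Num.truncn (4 / l)).+1, N => n Nn.
  have n0 : (0 < n)%N := leq_ltn_trans (leq0n _) Nn.
  rewrite pX // -[leRHS](powRr0 n%:R); apply: ler_powR; first by rewrite ler1n.
  have /= gn := gN n (ltnW Nn).
  have := truncnS_gt (4 / l); rewrite ltr_pdivrMr // => d4.
  by rewrite subr_le0; nra.
(* Here the limit is at most 0, so eventually [g n < 1 / (M + 1)] and [g n * M <= 1]. *)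
- move=> M; have M0 : 0 < (M.+1%:R : R)^-1 by rewrite invr_gt0 ltr0n.
  have [N _ gN] := cvgr_lt _ gl _ (le_lt_trans l0 M0).
  exists N => n Nn; have n0 : (0 < n)%N := leq_ltn_trans (leq0n _) Nn.
  rewrite -[n%:R]expr1 pX // -[leLHS](powRr0 n%:R).
  apply: ler_powR; first by rewrite ler1n.
  have /= := gN n (ltnW Nn); rewrite subr_ge0 => /ltW gn.
  apply: (@le_trans _ _ (M.+1%:R^-1 * M%:R)); first by rewrite ler_wpM2r ?ler0n.
  by rewrite mulrC ler_pdivrMr ?ltr0n // mul1r ler_nat.
Qed.

(** Take [L] maximal with [(b * L) ^ k <= n]; as [L >= 1], the next multiple satisfies
    [b * L.+1 <= 2 * b * L]. *)
Lemma root_approx b k n : (0 < k)%N -> (0 < b)%N -> (b ^ k <= n)%N ->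
  exists L : nat, ((b * L) ^ k <= n <= (2 * b) ^ k * L ^ k)%N.
Proof.
move=> k0 b0 bn; pose P L := ((b * L) ^ k <= n)%N.
have P1 : exists L, P L by exists 1%N; rewrite /P muln1.
have Pn L : P L -> (L <= n)%N.
  move/(leq_trans _); apply; apply: (@leq_trans (b * L)); first exact: leq_pmull.
  by case: (b * L)%N => // x; rewrite -{1}[x.+1]expn1 leq_pexp2l.
case: (ex_maxnP P1 Pn) => L PL maxL; exists L; rewrite [X in X && _]PL /=.
have L1 : (0 < L)%N by apply: maxL; rewrite /P muln1.
apply: (@leq_trans ((b * L.+1) ^ k)).
  by apply: ltnW; rewrite ltnNge; apply/negP => /maxL; rewrite ltnn.
by rewrite -expnMn leq_exp2r //; nia.
Qed.

(* The number [B = j * L] of blocks is chosen so that [k * B] is about the [k]-th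
   root of [n]; since [n * a ^ 2k >= 1], the product [L * a] is a positive power of
   [n] up to a constant, and [(1 - a) ^ L <= 1 / (L * a)] by Bernoulli. *)
Lemma dense_tail (R : realType) (p : nat -> R) k d : (0 < k)%N ->
  (forall n, 0 <= p n <= 1) ->
  (forall M : nat, exists n0 : nat, forall n : nat, (n0 < n)%N ->
     1 <= n%:R * p n ^+ M) ->
  exists n0 : nat, forall n : nat, (n0 < n)%N -> exists B : nat,
    ((k * B) ^ k <= n)%N /\ (1 - p n ^+ (2 ^ k)) ^+ B <= 1 / n%:R ^+ d.
Proof.
move=> k0 p01 /(_ (2 ^ k * (2 * k))%N)[N dense].
(* The factor [d.+1] in [j], in place of [d], leaves a spare power of [n] to absorb the constant
   [(C ^ 2) ^ d.+1]. By the choice of [L] below, [n <= C * L ^ k]. *)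
pose j := (2 * k * d.+1)%N; pose C := ((2 * (k * j)) ^ k)%N.
exists (N + (k * j) ^ k + (C ^ 2) ^ d.+1)%N => n nlarge.
have kj0 : (0 < k * j)%N by rewrite /j !muln_gt0 k0.
have kjn : ((k * j) ^ k <= n)%N by lia.
have [L /andP[Ln nL]] := root_approx _ _ _ k0 kj0 kjn.
exists (j * L)%N; split; first by rewrite mulnA.
have n0 : (0 < n)%N by lia.
have {dense} := dense n _; rewrite exprM => /(_ ltac:(lia)).
set a := p n ^+ (2 ^ k) => an.
have /andP[a0 a1] : 0 <= a <= 1.
  by have /andP[? ?] := p01 n; rewrite exprn_ge0 ?exprn_ile1.
pose y : R := (1 - a) ^+ L.
have y0 : 0 <= y by rewrite exprn_ge0 // subr_ge0.
have yLa : y * (L%:R * a) <= 1.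
  (* Bernoulli gives [L * a <= (1 + a) ^ L], and [(1 - a) * (1 + a) <= 1]. *)
  apply: (@le_trans _ _ (y * (1 + a) ^+ L)).
    apply: ler_wpM2l => //; rewrite mulr_natl.
    have : 1 + a *+ L <= (1 + a) ^+ L.
      elim: (L) => [|l IHl]; first by rewrite mulr0n addr0.
      rewrite exprS mulrSr; have : 0 <= a *+ l by rewrite mulrn_wge0.
      by nra.
    by apply: le_trans; rewrite lerDr.
  rewrite /y -exprMn; apply: exprn_ile1; nra.
have yn : y ^+ (2 * k) * n%:R <= (C ^ 2)%:R.
  have step1 : n%:R <= (C ^ 2)%:R * (L%:R * a) ^+ (2 * k) :> R.
    rewrite exprMn mulrA; apply: (@le_trans _ _ (n%:R ^+ 2 * a ^+ (2 * k))).
      by rewrite expr2 -mulrA ler_peMr // ler0n.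
    apply: ler_wpM2r; first exact: exprn_ge0.
    rewrite -!natrX -natrM ler_nat [(2 * k)%N]mulnC expnM -expnMn leq_exp2r //.
  apply: (@le_trans _ _ ((C ^ 2)%:R * (y * (L%:R * a)) ^+ (2 * k))).
    by rewrite exprMn mulrCA; apply: ler_wpM2l step1; exact: (exprn_ge0 _ y0).
  apply: ler_piMr; first exact: ler0n.
  by apply: exprn_ile1 => //; rewrite !mulr_ge0 ?ler0n.
rewrite ler_pdivlMr ?exprn_gt0 ?ltr0n //.
rewrite mulnC exprM -/y /j exprM.
rewrite -(ler_pM2r (_ : 0 < n%:R :> R)) ?ltr0n // -mulrA -exprSr -exprMn mul1r.
apply: (@le_trans _ _ ((C ^ 2)%:R ^+ d.+1)).
  apply: lerXn2r yn; rewrite nnegrE ?ler0n //.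
  by rewrite mulr_ge0 ?ler0n // (exprn_ge0 _ y0).
by rewrite -natrX ler_nat; lia.
Qed.

(** For [n >= 1], [q(n)] is at most the sum [S] of the absolute coefficients times [n ^ size q], and
    the extra factor [n] exceeds [S]. *)
Lemma horner_lt_pow (R : realType) (q : {poly R}) :
  exists n0 : nat, forall n : nat, (n0 < n)%N ->
    q.[n%:R] < n%:R ^+ (size q).+1.
Proof.
pose S : R := \sum_(i < size q) `|q`_i|.
exists (Num.truncn S).+1 => n nS.
have n0 : (0 < n)%N by lia.
have Sn : S < n%:R.
  by apply: lt_trans (truncnS_gt S) _; rewrite ltr_nat.
rewrite horner_coef; apply: (@le_lt_trans _ _ (S * n%:R ^+ size q)).
  rewrite mulr_suml; apply: ler_sum => i _.
  apply: (@le_trans _ _ (`|q`_i| * n%:R ^+ i)).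
    by rewrite ler_wpM2r ?exprn_ge0 ?ler0n ?ler_norm.
  by apply: ler_wpM2l => //; apply: ler_weXn2l; [rewrite ler1n|exact: ltnW].
by rewrite exprS ltr_pM2r // exprn_gt0 ?ltr0n.
Qed.

(** * Typical running time *)

(** [ev] is the bad event: outside it the search succeeds below [v], or [v = n], and the tree below
    [v] has size at most [N]. *)
Lemma slow_gnp_prob (R : realType) n (r : R) k v N T (ev : pred (sgraph n)) :
  0 <= r <= 1 -> (v <= n)%N ->
  (forall G, ~~ ev G -> found (nat_adj G) k [::] v || (v == n)) ->
  (forall G, ~~ ev G -> (nodes (nat_adj G) k [::] v <= N)%N) ->
  (4 * n + 11 + step_cost k * N.+1 <= T)%N ->
  gnp_prob r (fun G : sgraph n => (T%:R%:E < runtime R clique_prog G k)%E) <=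
  gnp_prob r ev.
Proof.
move=> r01 vn fnd le_nodes le_T; apply: gnp_prob_le => // G.
apply: contraTT => evG; rewrite -leNgt.
apply: le_trans (clique_prog_time R n G k v vn (fnd _ evG)) _.
rewrite lee_fin ler_nat; apply: leq_trans le_T.
by rewrite leq_add2l leq_mul2l ltnS le_nodes ?orbT.
Qed.

Lemma typical_time_sparse (R : realType) (p : nat -> R) (s : nat) :
  (forall n, 0 <= p n <= 1) ->
  (exists n0 : nat, forall n : nat, (n0 < n)%N -> n%:R ^+ 2 * p n ^+ s <= 1) ->
  forall k d : nat, exists n0 : nat, forall n : nat, (n0 < n)%N ->
    gnp_prob (p n) (fun G : sgraph n =>
      (((18 * k + 84) * (3 * n.+1) ^ s.+2)%N%:R%:E < runtime R clique_prog G k)%E)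
      <= 1 / n%:R ^+ d.
Proof.
(* With this [t], [s + t + d = 2 * t], so the biclique bound times [n ^ d] is
   [(n ^ 2 * p ^ s) ^ t <= 1]. The threshold makes [t.+1 ^ k <= n], so that this factor costs one
   more power of [n]. *)
move=> p01 [n0 sparse] k d; pose t := (s + d)%N.
exists (n0 + t.+1 ^ k)%N => n nlarge; have /andP[r0 r1] := p01 n.
have npos : (0 < n)%N by lia.
apply: le_trans (slow_gnp_prob R n (p n) k n ((3 * n.+1) ^ s.+1 * t.+1 ^ k) _
  (biclique n s t) (p01 n) (leqnn n) _ _ _) _.
- by move=> G _; rewrite eqxx orbT.
- by move=> G; exact: nodes_le_biclique.
- have Z0 : (3 * n.+1 <= (3 * n.+1) ^ s.+2)%N.
    by rewrite -{1}[(3 * n.+1)%N]expn1 leq_pexp2l.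
  have : ((3 * n.+1) ^ s.+1 * t.+1 ^ k <= (3 * n.+1) ^ s.+2)%N.
    by rewrite [leqRHS]expnSr leq_mul2l; apply/orP; right; lia.
  move: Z0; set Z := ((3 * n.+1) ^ s.+2)%N; set Y := (_ * _ ^ k)%N.
  by rewrite /step_cost; clearbody Z Y; nia.
apply: le_trans (gnp_prob_biclique R n (p n) s t (p01 n)) _.
rewrite ler_pdivlMr ?exprn_gt0 ?ltr0n // mulrAC -exprD.
rewrite (_ : s + t + d = 2 * t)%N; last by rewrite /t; lia.
by rewrite !exprM -exprMn exprn_ile1 ?sparse ?mulr_ge0 ?exprn_ge0 ?ler0n //; lia.
Qed.

Lemma typical_time_dense (R : realType) (p : nat -> R) :
  (forall n, 0 <= p n <= 1) ->
  (forall M : nat, exists n0 : nat, forall n : nat, (n0 < n)%N ->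
     1 <= n%:R * p n ^+ M) ->
  forall k d : nat, exists n0 : nat, forall n : nat, (n0 < n)%N ->
    gnp_prob (p n) (fun G : sgraph n =>
      (((18 * k + 84) * 3 ^ k * (3 * n.+1))%N%:R%:E < runtime R clique_prog G k)%E)
      <= 1 / n%:R ^+ d.
Proof.
move=> p01 dense k d.
suff [n0 small] : exists n0 : nat, forall n : nat, (n0 < n)%N ->
    exists v : nat, [/\ (v <= n)%N, (v ^ k <= n)%N &
      gnp_prob (p n) (fun G : sgraph n => ~~ found (nat_adj G) k [::] v) <=
      1 / n%:R ^+ d].
  exists n0 => n /small[v [vn vkn]]; apply: le_trans.
  apply: (slow_gnp_prob R n (p n) k v (3 ^ k * n)) (p01 n) vn _ _ _.
  - by move=> G; rewrite negbK => ->.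
  - move=> G _; apply: leq_trans (nodes_le _ _ _ _ v (leqnn v)) _.
    by rewrite expnMn leq_mul2l vkn orbT.
  - rewrite /step_cost; have := expn_gt0 3 k; set Z := (3 ^ k)%N => /= Z0.
    by clearbody Z; nia.
case: k => [|k].
  (* For [k = 0] the search succeeds at once. *)
  exists 0%N => n n0; exists 0%N; split=> //.
  by rewrite /gnp_prob big_pred0 // divr_ge0 ?exprn_ge0 ?ler0n.
have [n0 tail] := dense_tail R p k.+1 d isT p01 dense.
exists n0 => n /tail[B [kBn small]]; exists (k.+1 * B)%N.
have kBn1 : (k.+1 * B <= n)%N.
  apply: leq_trans kBn; case: (k.+1 * B)%N => // x.
  by rewrite -{1}[x.+1]expn1 leq_pexp2l.
split=> //; apply: le_trans small; exact: gnp_prob_not_found.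
Qed.

Local Open Scope classical_set_scope.

Theorem theorem2 (R : realType) (p : nat -> R)
    (p01 : forall n : nat, 0 <= p n <= 1) (p_nat : natural_fun p) :
  exists A : program,
    decides_clique A /\
    exists (f : nat -> nat) (P : {poly R}),
      forall (k : nat) (q : {poly R}),
        (\forall n \near \oo, 0 < q.[n%:R]) ->
        exists n0 : nat, forall n : nat, (n0 < n)%N ->
          gnp_prob (p n)
            (fun G : sgraph n =>
               (((f k)%:R * P.[n%:R])%:E < runtime R A G k)%E)
          < 1 / q.[n%:R].
Proof.
exists clique_prog; split; first exact: clique_prog_decides.
(* The bounds [1 / n ^ d] suffice, since eventually [q(n) < n ^ d] for [d = (size q).+1]. Note that
   [f] and [s] are fixed before [k] and [d]. *)
suff [f [s typical]] : exists (f : nat -> nat) (s : nat), forall k d : nat,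
    exists n0 : nat, forall n : nat, (n0 < n)%N ->
    gnp_prob (p n) (fun G : sgraph n =>
      ((f k * (3 * n.+1) ^ s)%N%:R%:E < runtime R clique_prog G k)%E)
      <= 1 / n%:R ^+ d.
  exists f, ((3%:R *: ('X + 1)) ^+ s) => k q [N _ q0].
  have [n1 qlt] := horner_lt_pow R q.
  have [n2 small] := typical k (size q).+1.
  exists (N + n1 + n2)%N => n nlarge.
  rewrite (_ : (f k)%:R * _ = (f k * (3 * n.+1) ^ s)%N%:R); last first.
    by rewrite horner_exp !hornerE natr1 natrM natrX natrM.
  apply: le_lt_trans (small n _) _; first by lia.
  have qn : 0 < q.[n%:R] by apply: q0 => /=; lia.
  by rewrite !div1r ltf_pV2 ?posrE ?exprn_gt0 ?ltr0n ?qlt //; lia.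
case: (natural_fun_dichotomy R p p_nat) => [[s sparse]|dense].
  exists (fun k => 18 * k + 84)%N, s.+2; exact: typical_time_sparse.
exists (fun k => (18 * k + 84) * 3 ^ k)%N, 1%N => k d.
have [n0 typical] := typical_time_dense R p p01 dense k d.
by exists n0 => n; rewrite expn1; exact: typical.
Qed.
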